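(* Consider a multiobjective linear program with $p$ objectives and outcome set $Y^=\subseteq\mathbb{E}_p$, let $\widehat{\mathbf y}\in\mathbb{E}_p$ satisfy $\widehat{\mathbf y}<\mathbf y$ for all $\mathbf y\in Y^=$, and let $Y^\square=\{\mathbf z\in\mathbb{E}_p : \widehat{\mathbf y}\le\mathbf z\le\mathbf y\text{ for some }\mathbf y\in Y^=\}$. Then the polytope $Y^\square$ has at least $2^p-1$ non-efficient vertices; that is, at least $2^p-1$ vertices that are not efficient extreme outcomes of the multiobjective linear program.
   Context: $\mathbb{E}_d$ denotes $d$-dimensional Euclidean space; the vector relations $\le$ and $<$ are componentwise (with $<$ meaning strict in every component); a polytope is a bounded intersection of finitely many closed half-spaces. Multiobjective linear program: given an $m\times n$ real matrix $A$, $\mathbf b\in\mathbb{R}^m$ and a $p\times n$ real objective matrix $C$, the feasible set $X=\{\mathbf x\in\mathbb{E}_n : A\mathbf x=\mathbf b,\ \mathbf x\ge\mathbf 0\}$ is assumed to be nonempty and bounded, and the outcome set is the polytope $Y^==\{C\mathbf x:\mathbf x\in X\}\subseteq\mathbb{E}_p$. For a polytope $Z\subseteq\mathbb{E}_p$, a point $\mathbf z\in Z$ is efficient in $Z$ if there is no other $\mathbf z'\in Z$, $\mathbf z'\ne\mathbf z$, with $\mathbf z'\ge\mathbf z$; a vertex of $Z$ is non-efficient if it is not efficient in $Z$. The efficient extreme outcomes are the vertices of $Y^=$ that are efficient in $Y^=$. The set $Y^\square$ is a polytope whose efficient points are exactly those of $Y^=$. *)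

(* Defs.v *)
From HB Require Import structures.
From mathcomp Require Import all_boot all_order all_algebra.
From mathcomp Require Import all_classical all_reals all_analysis.

Set Implicit Arguments.
Unset Strict Implicit.
Unset Printing Implicit Defensive.

Import Order.TTheory GRing.Theory Num.Theory.
Import numFieldNormedType.Exports.

Local Open Scope classical_set_scope.
Local Open Scope ring_scope.

Definition vec_le (R : realType) (d : nat) (u v : 'cV[R]_d) : Prop :=
  forall i : 'I_d, u i 0 <= v i 0.

(* Strict in every component, so not the strict part of [vec_le]. *)
Definition vec_lt (R : realType) (d : nat) (u v : 'cV[R]_d) : Prop :=
  forall i : 'I_d, u i 0 < v i 0.

Definition feasible_set (R : realType) (m n : nat) (A : 'M[R]_(m, n))
    (b : 'cV[R]_m) : set 'cV[R]_n :=
  [set x | A *m x = b /\ vec_le 0 x].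

Definition outcome_set (R : realType) (m n p : nat) (A : 'M[R]_(m, n))
    (b : 'cV[R]_m) (C : 'M[R]_(p, n)) : set 'cV[R]_p :=
  [set C *m x | x in feasible_set A b].

Definition outcome_box (R : realType) (p : nat) (yhat : 'cV[R]_p)
    (Y : set 'cV[R]_p) : set 'cV[R]_p :=
  [set z | vec_le yhat z /\ exists2 y, Y y & vec_le z y].

Definition efficient (R : realType) (p : nat) (Z : set 'cV[R]_p)
    (z : 'cV[R]_p) : Prop :=
  Z z /\ ~ (exists z', [/\ Z z', z' <> z & vec_le z z']).

(* The vertices of a polytope are its extreme points: the points of [Z] that
   lie in the relative interior of no nondegenerate segment contained in [Z]. *)
Definition vertex (R : realType) (p : nat) (Z : set 'cV[R]_p)
    (z : 'cV[R]_p) : Prop :=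
  Z z /\ forall (x y : 'cV[R]_p) (t : R), Z x -> Z y -> 0 < t -> t < 1 ->
    z = t *: x + (1 - t) *: y -> x = z /\ y = z.

Definition non_efficient_vertex (R : realType) (p : nat) (Z : set 'cV[R]_p)
    (z : 'cV[R]_p) : Prop :=
  vertex Z z /\ ~ efficient Z z.

Definition efficient_extreme_outcome (R : realType) (m n p : nat)
    (A : 'M[R]_(m, n)) (b : 'cV[R]_m) (C : 'M[R]_(p, n))
    (z : 'cV[R]_p) : Prop :=
  vertex (outcome_set A b C) z /\ efficient (outcome_set A b C) z.

(* Main.v *)
Require Import Defs.
From HB Require Import structures.
From mathcomp Require Import all_boot all_order all_algebra.
From mathcomp Require Import all_classical all_reals all_analysis.
From mathcomp Require Import ring.

(** For each proper subset [S] of the coordinates, let [y] be an outcome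
    maximizing the squared distance to [yhat] in the coordinates of [S] (it
    exists by compactness of the feasible set), and replace by those of [yhat]
    the coordinates of [y] outside [S].  The resulting point still maximizes
    this distance over the whole box, where it is monotone, and it is minimal
    in the other coordinates, so it is a vertex by strict convexity of the
    square.  It is dominated by [y], from which it differs as [S] is proper,
    and [S] is recovered as the set of coordinates where it exceeds [yhat], so
    the [2 ^ p - 1] proper subsets yield distinct non-efficient vertices. *)

Set Implicit Arguments.
Unset Strict Implicit.

Import Order.TTheory GRing.Theory Num.Theory.
Import numFieldNormedType.Exports.

Local Open Scope classical_set_scope.
Local Open Scope ring_scope.

Lemma mulmx_trmx_coord_continuous (R : realType) (k n : nat) (M : 'M[R]_(k, n))
  (i : 'I_k) : continuous (fun v : 'rV[R]_n => (M *m v^T) i 0).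
Proof.
under eq_fun do rewrite mxE.
apply: continuous_big => [|j _ v]; first exact: add_continuous.
under eq_fun do rewrite mxE.
by apply: continuousM; [exact: cst_continuous|exact: coord_continuous].
Qed.

Lemma norm_trmx (R : realType) (m n : nat) (M : 'M[R]_(m, n)) : `|M^T| = `|M|.
Proof.
suff le_norm_trmx k l (N : 'M[R]_(k, l)) : `|N^T| <= `|N|.
  by apply/eqP; rewrite eq_le le_norm_trmx -{1}[M]trmxK le_norm_trmx.
rewrite /Num.norm /= !mx_normrE; apply/bigmax_leP; split=> [|[j i] _ /=].
  exact: bigmax_ge_id.
by rewrite mxE; exact: (le_bigmax _ (fun ij => `|N ij.1 ij.2|) (i, j)).
Qed.

(** Heine-Borel: the constraints are closed conditions on continuous coordinates. Feasible points
    are transposed into rows because [bounded_closed_compact] is about row vectors; [norm_trmx]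
    carries the bound across. *)
Lemma compact_feasible_rows (R : realType) (m n : nat) (A : 'M[R]_(m, n))
  (b : 'cV[R]_m) : bounded_set (feasible_set A b) ->
  compact [set v : 'rV[R]_n | feasible_set A b v^T].
Proof.
move=> [N [Nreal bndN]]; apply: bounded_closed_compact.
  exists N; split=> // r /bndN bndr v /bndr /=.
  by rewrite norm_trmx.
have -> : [set v : 'rV[R]_n | feasible_set A b v^T] =
    (\bigcap_i [set v | (A *m v^T) i 0 = b i 0]) `&`
    (\bigcap_i [set v : 'rV[R]_n | 0 <= v 0 i]).
  apply/seteqP; split=> v /=.
    move=> [Av v_ge0]; split=> i _ /=; first by rewrite Av.
    by have := v_ge0 i; rewrite !mxE.
  move=> [Av v_ge0]; split; last by move=> i; rewrite !mxE; exact: v_ge0.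
  by apply/colP => i; exact: Av.
apply: closedI; apply: closed_bigI => i _.
  apply: (@preimage_closed _ _ (fun v : 'rV[R]_n => (A *m v^T) i 0)
    [set x | x = b i 0]).
    by move=> v _; exact: mulmx_trmx_coord_continuous.
  exact: closed_eq.
apply: (@preimage_closed _ _ (fun v : 'rV[R]_n => v 0 i) [set x | 0 <= x]).
  by move=> v _; exact: coord_continuous.
exact: closed_ge.
Qed.

(** The extreme value theorem, applied to the distance pulled back along [C] to the feasible set, so
    that compactness is needed only there. *)
Lemma outcome_farthest (R : realType) (m n p : nat) (A : 'M[R]_(m, n))
  (b : 'cV[R]_m) (C : 'M[R]_(p, n)) (c : 'cV[R]_p) (S : {set 'I_p}) :
  feasible_set A b !=set0 -> bounded_set (feasible_set A b) ->
  exists2 y, outcome_set A b C y &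
    forall y', outcome_set A b C y' ->
      \sum_(i in S) (y' i 0 - c i 0) ^+ 2 <= \sum_(i in S) (y i 0 - c i 0) ^+ 2.
Proof.
move=> [x0 Xx0] /compact_feasible_rows cX.
pose f (v : 'rV[R]_n) := \sum_(i in S) ((C *m v^T) i 0 - c i 0) ^+ 2.
have f_cont : continuous f.
  apply: continuous_big => [|i _ v]; first exact: add_continuous.
  have g_cont : {for v, continuous (fun v : 'rV[R]_n => (C *m v^T) i 0 - c i 0)}.
    by apply: continuousB;
      [exact: mulmx_trmx_coord_continuous|exact: cst_continuous].
  exact: (continuousM g_cont g_cont).
have X0 : [set v : 'rV[R]_n | feasible_set A b v^T] !=set0.
  by exists x0^T; rewrite /= trmxK.
have [v /set_mem Xv fmax] :=
  compact_EVT_max X0 cX (continuous_subspaceT f_cont).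
exists (C *m v^T); first by exists v^T.
move=> _ [x Xx <-]; have := fmax x^T; rewrite /f trmxK; apply.
by apply/mem_set; rewrite /= trmxK.
Qed.

Definition restrict_above (R : realType) (p : nat) (c : 'cV[R]_p)
  (S : {set 'I_p}) (y : 'cV[R]_p) : 'cV[R]_p :=
  \col_i (if i \in S then y i 0 else c i 0).

(** Subtracting [c] leaves two nonnegative terms with sum zero and positive weights. This settles
    the coordinates outside [S], where [c] bounds the box from below. *)
Lemma convex_comb_eq_lb (R : realDomainType) (t c a b : R) :
  0 < t -> t < 1 -> c <= a -> c <= b -> c = t * a + (1 - t) * b ->
  a = c /\ b = c.
Proof.
move=> t0 t1 ca cb e.
have s0 : 0 < 1 - t by rewrite subr_gt0.
have : t * (a - c) + (1 - t) * (b - c) = 0.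
  by rewrite [RHS](_ : _ = t * a + (1 - t) * b - c); [ring|rewrite -e subrr].
have ta_ge0 : 0 <= t * (a - c) by rewrite mulr_ge0 ?subr_ge0 ?(ltW t0).
have sb_ge0 : 0 <= (1 - t) * (b - c) by rewrite mulr_ge0 ?(ltW s0) ?subr_ge0.
move/eqP; rewrite paddr_eq0// !mulf_eq0 (gt_eqF t0) (gt_eqF s0) !subr_eq0.
by move=> /andP[/eqP-> /eqP->].
Qed.

Section box_vertex.
Variables (R : realType) (p : nat) (Y : set 'cV[R]_p) (c : 'cV[R]_p).
Hypothesis c_lt : forall y, Y y -> vec_lt c y.
Variables (S : {set 'I_p}) (y : 'cV[R]_p).
Hypothesis Yy : Y y.

Let z := restrict_above c S y.

Lemma restrict_above_le : vec_le z y.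
Proof. by move=> i; rewrite mxE; case: ifP => // _; exact/ltW/c_lt. Qed.

Lemma outcome_box_restrict_above : outcome_box c Y z.
Proof.
split; last by exists y => //; exact: restrict_above_le.
by move=> i; rewrite mxE; case: ifP => // _; exact/ltW/c_lt.
Qed.

Lemma restrict_above_gtE (i : 'I_p) : (c i 0 < z i 0) = (i \in S).
Proof. by rewrite mxE; case: ifP; rewrite ?ltxx// => _; exact: c_lt. Qed.

Lemma not_efficient_restrict_above : S != [set: 'I_p]%SET ->
  ~ efficient (outcome_box c Y) z.
Proof.
move=> ST [_]; apply; exists y; split; last exact: restrict_above_le.
  by split; [move=> i; exact/ltW/c_lt|exists y].
(* If [y] were [z], every coordinate of [z] would exceed that of [c], making [S] the full set. *)
move=> yz; case/negP: ST; apply/eqP/setP => i.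
by rewrite -restrict_above_gtE -yz inE; exact: c_lt.
Qed.

Hypothesis y_farthest : forall y', Y y' ->
  \sum_(i in S) (y' i 0 - c i 0) ^+ 2 <= \sum_(i in S) (y i 0 - c i 0) ^+ 2.

(** A point of the box lies between [c] and some outcome [y'], and squaring is monotone on
    nonnegative numbers; on [S], [z] agrees with [y]. *)
Lemma outcome_box_farthest (w : 'cV[R]_p) : outcome_box c Y w ->
  \sum_(i in S) (w i 0 - c i 0) ^+ 2 <= \sum_(i in S) (z i 0 - c i 0) ^+ 2.
Proof.
move=> [cw [y' Yy' wy']].
rewrite [leRHS](eq_bigr (fun i => (y i 0 - c i 0) ^+ 2)); last first.
  by move=> i iS; rewrite mxE iS.
apply: le_trans (y_farthest Yy'); apply: ler_sum => i _.
by rewrite lerXn2r ?nnegrE ?subr_ge0 ?lerD2r//; exact/ltW/c_lt.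
Qed.

Lemma vertex_restrict_above : vertex (outcome_box c Y) z.
Proof.
split; first exact: outcome_box_restrict_above.
move=> u v t Zu Zv t0 t1 zE.
have ziE i : z i 0 = t * u i 0 + (1 - t) * v i 0 by rewrite zE !mxE.
have s0 : 0 < 1 - t by rewrite subr_gt0.
have uv_gap : \sum_(i in S) t * (1 - t) * (u i 0 - v i 0) ^+ 2 <= 0.
  (* Strict convexity in exact form: the gap between the weighted squares and the square of the
     weighted mean is [t * (1 - t)] times the squared difference. It is at most zero in total
     because neither [u] nor [v] is farther than [z]. *)
  have -> : \sum_(i in S) t * (1 - t) * (u i 0 - v i 0) ^+ 2 =
      t * \sum_(i in S) (u i 0 - c i 0) ^+ 2 +
      (1 - t) * \sum_(i in S) (v i 0 - c i 0) ^+ 2 -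
      \sum_(i in S) (z i 0 - c i 0) ^+ 2.
    rewrite !mulr_sumr -big_split -sumrB; apply: eq_bigr => i _ /=.
    by rewrite ziE; ring.
  rewrite subr_le0.
  apply: le_trans (_ : t * \sum_(i in S) (z i 0 - c i 0) ^+ 2 +
    (1 - t) * \sum_(i in S) (z i 0 - c i 0) ^+ 2 <= _).
    by rewrite lerD// ler_pM2l//; exact: outcome_box_farthest.
  by rewrite -mulrDl addrC subrK mul1r.
have gap_ge0 i : i \in S -> 0 <= t * (1 - t) * (u i 0 - v i 0) ^+ 2.
  by move=> _; rewrite mulr_ge0 ?sqr_ge0// mulr_ge0 ?ltW.
have uv_on_S i : i \in S -> u i 0 = v i 0.
  move=> iS; apply/eqP; rewrite -subr_eq0 -sqrf_eq0.
  have /eqP : \sum_(i in S) t * (1 - t) * (u i 0 - v i 0) ^+ 2 = 0.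
    by apply/eqP; rewrite eq_le uv_gap sumr_ge0.
  rewrite psumr_eq0// => /allP /(_ i (mem_index_enum _)); rewrite iS /=.
  by rewrite mulf_eq0 mulf_eq0 (gt_eqF t0) (gt_eqF s0).
suff uvz i : u i 0 = z i 0 /\ v i 0 = z i 0.
  by split; apply/colP => i; have [] := uvz i.
have [iS|iS] := boolP (i \in S).
  by rewrite ziE (uv_on_S _ iS); split; ring.
have zc : z i 0 = c i 0 by rewrite mxE (negbTE iS).
by apply: convex_comb_eq_lb t0 t1 _ _ (ziE i); rewrite zc;
  [exact: Zu.1|exact: Zv.1].
Qed.

End box_vertex.

Lemma card_proper_subsets (p : nat) :
  #|[set~ [set: 'I_p]%SET]%SET| = (2 ^ p - 1)%N.
Proof.
by rewrite cardsC1 -cardsT -powersetT card_powerset cardsT card_ord subn1.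
Qed.

(** [enum_val] lists [D] by ordinals, so composing it with [f] injects an initial segment into
    [B]. *)
Lemma card_le_finset_inj (I : finType) (T : Type) (D : {set I}) (B : set T)
  (f : I -> T) : {in D, forall i, B (f i)} -> {in D &, injective f} ->
  (`I_#|D| #<= B)%card.
Proof.
move=> fB f_inj.
rewrite (card_le_eql card_II).
have g_inj : {in [set: 'I_#|D|] &, injective (fun k => f (enum_val k))}.
  move=> k l _ _ /f_inj; rewrite !enum_valP => /(_ isT isT).
  exact: enum_val_inj.
rewrite -(card_le_eql (inj_card_eq g_inj)); apply: subset_card_le.
by move=> _ [k _ <-]; exact/fB/enum_valP.
Qed.

Theorem corollary4p11 (R : realType) (m n p : nat)
  (A : 'M[R]_(m, n)) (b : 'cV[R]_m) (C : 'M[R]_(p, n))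
  (X_nonempty : feasible_set A b !=set0)
  (X_bounded : bounded_set (feasible_set A b))
  (yhat : 'cV[R]_p)
  (yhat_lt : forall y, outcome_set A b C y -> vec_lt yhat y) :
  (`I_(2 ^ p - 1)%N #<=
     [set z | non_efficient_vertex (outcome_box yhat (outcome_set A b C)) z])%card
  /\
  (`I_(2 ^ p - 1)%N #<=
     [set z | vertex (outcome_box yhat (outcome_set A b C)) z /\
              ~ efficient_extreme_outcome A b C z])%card.
Proof.
set Y := outcome_set A b C.
suff nev : (`I_(2 ^ p - 1)%N #<=
    [set z | non_efficient_vertex (outcome_box yhat Y) z])%card.
  split=> //; apply: card_le_trans nev _; apply: subset_card_le => z /= [vz nz].
  (* A point efficient in [Y] is efficient in the box: a dominating [z'] lies below some outcome
     [y], which then dominates [z] too; [y] differs from [z], since otherwise antisymmetry would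
     give [z' = z]. *)
  split=> // -[_ [Yz z_max]]; apply: nz; split; first exact: vz.1.
  move=> [z' [[_ [y Yy z'y]] z'z zz']]; apply: z_max; exists y; split=> //.
    move=> yz; apply: z'z; apply/colP => i; apply/eqP.
    by rewrite eq_le zz' andbT -yz z'y.
  by move=> i; exact: le_trans (zz' i) (z'y i).
(* One farthest outcome is fixed for each [S], so that the vertex becomes a function of [S]. *)
have /choice[y y_far] (S : {set 'I_p}) : exists y, Y y /\ forall y', Y y' ->
    \sum_(i in S) (y' i 0 - yhat i 0) ^+ 2 <=
    \sum_(i in S) (y i 0 - yhat i 0) ^+ 2.
  by have [y] := outcome_farthest C yhat S X_nonempty X_bounded; exists y.
rewrite -card_proper_subsets.
apply: (@card_le_finset_inj _ _ _ _ (fun S => restrict_above yhat S (y S))).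
  move=> S; rewrite !inE => ST; have [Yy far] := y_far S; split.
    exact: vertex_restrict_above.
  exact: not_efficient_restrict_above.
move=> S S' _ _ eqSS'; apply/setP => i.
(* Both sides are read off as the coordinates exceeding [yhat], whichever outcomes were chosen. *)
have gtE T := restrict_above_gtE yhat_lt T (y_far T).1.
by rewrite -gtE eqSS' gtE.
Qed.
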